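(* Any $3$-dimensional nontrivial quadratic Novikov algebra over $\mathbb{C}$ is isomorphic to a quadratic Novikov algebra $(A=\mathbb{C}e_1\oplus\mathbb{C}e_2\oplus\mathbb{C}e_3,\circ,B(\cdot,\cdot))$ which is one of the following (each given by the characteristic matrix $(e_i\circ e_j)_{i,j}$ and the metric matrix $(B(e_i,e_j))_{i,j}$): Type (A7) ($l=-2$): characteristic matrix $\begin{pmatrix}0&0&0\\0&0&e_1\\0&-2e_1&e_2\end{pmatrix}$, metric matrix $\begin{pmatrix}0&0&k\\0&k&0\\k&0&t\end{pmatrix}$, with $k,t\in\mathbb{C}$, $k^3\neq0$; Type (C5) ($l=-2$): characteristic matrix $\begin{pmatrix}0&0&e_1\\0&0&0\\-2e_1&0&e_3\end{pmatrix}$, metric matrix $\begin{pmatrix}0&0&k\\0&s&0\\k&0&0\end{pmatrix}$, with $k,s\in\mathbb{C}$, $k^2s\neq0$; Type (D6) ($l=-\frac12$): characteristic matrix $\begin{pmatrix}e_2&0&e_1\\0&0&e_2\\-\frac12e_1&-2e_2&e_3\end{pmatrix}$, metric matrix $\begin{pmatrix}-2s&0&0\\0&0&s\\0&s&0\end{pmatrix}$, with $s\in\mathbb{C}$, $s^3\neq0$.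
   Context: A Novikov algebra $(A,\circ)$ over $\mathbb{C}$ is a $\mathbb{C}$-vector space with a bilinear operation $\circ$ such that $(a\circ b)\circ c-a\circ(b\circ c)=(b\circ a)\circ c-b\circ(a\circ c)$ and $(a\circ b)\circ c=(a\circ c)\circ b$ for all $a,b,c\in A$. It is trivial if $a\circ b=0$ for all $a,b\in A$, and nontrivial otherwise. Put $a\star b:=a\circ b+b\circ a$. A quadratic Novikov algebra $(A,\circ,B(\cdot,\cdot))$ is a Novikov algebra with a nondegenerate symmetric bilinear form $B:A\times A\to\mathbb{C}$ such that $B(a\circ b,c)=-B(b,a\star c)$ for all $a,b,c\in A$; it is nontrivial if $(A,\circ)$ is nontrivial. An isomorphism of quadratic Novikov algebras $(A_1,\circ,B_1)\to(A_2,\circ,B_2)$ is a linear bijection $\varphi$ with $\varphi(a\circ b)=\varphi(a)\circ\varphi(b)$ and $B_1(a,b)=B_2(\varphi(a),\varphi(b))$ for all $a,b\in A_1$. In the characteristic matrix the entry in row $i$, column $j$ is $e_i\circ e_j$. The type names and values of $l$ are only labels. *)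

(* Defs.v *)
From HB Require Import structures.
From mathcomp Require Import all_boot all_order all_algebra.
From mathcomp Require Import sesquilinear reals complex.

Set Implicit Arguments.
Unset Strict Implicit.
Unset Printing Implicit Defensive.

Import GRing.Theory.
Local Open Scope ring_scope.

Record novikovAlg (K : fieldType) (V : lmodType K) := NovikovAlg {
  nov_mul :> {bilinear V -> V -> V};
  nov_lsym : forall a b c : V,
    nov_mul (nov_mul a b) c - nov_mul a (nov_mul b c)
    = nov_mul (nov_mul b a) c - nov_mul b (nov_mul a c);
  nov_rcomm : forall a b c : V,
    nov_mul (nov_mul a b) c = nov_mul (nov_mul a c) b
}.

Definition nov_trivial (K : fieldType) (V : lmodType K) (A : novikovAlg V) :=
  forall a b : V, A a b = 0.

Definition nov_star (K : fieldType) (V : lmodType K) (A : novikovAlg V)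
  (a b : V) : V := A a b + A b a.

(* [nondegenerate] is the library's notion for forms on a finite-dimensional
   space: the radical is zero. *)
Record quadNovikov (K : fieldType) (V : vectType K) := QuadNovikov {
  qn_alg :> novikovAlg V;
  qn_form : {symmetric V};
  qn_nondeg : nondegenerate qn_form;
  qn_inv : forall a b c : V,
    qn_form (qn_alg a b) c = - qn_form b (nov_star qn_alg a c)
}.

Definition qn_isomorphic (K : fieldType) (V W : vectType K)
    (A : quadNovikov V) (A' : quadNovikov W) :=
  exists phi : {linear V -> W},
    [/\ bijective phi,
        forall a b : V, phi (A a b) = A' (phi a) (phi b)
      & forall a b : V, qn_form A a b = qn_form A' (phi a) (phi b)].

Definition mx3 (T : nmodType) (rows : seq (seq T)) : 'M[T]_3 :=
  \matrix_(i < 3, j < 3) nth 0 (nth [::] rows i) j.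

Section Types.
Variable K : fieldType.

Definition e1 : 'rV[K]_3 := delta_mx 0 (@Ordinal 3 0 isT).
Definition e2 : 'rV[K]_3 := delta_mx 0 (@Ordinal 3 1 isT).
Definition e3 : 'rV[K]_3 := delta_mx 0 (@Ordinal 3 2 isT).

Definition char_mx (A : quadNovikov 'rV[K]_3) : 'M['rV[K]_3]_3 :=
  \matrix_(i < 3, j < 3) A (delta_mx 0 i) (delta_mx 0 j).

Definition metric_mx (A : quadNovikov 'rV[K]_3) : 'M[K]_3 :=
  \matrix_(i < 3, j < 3) qn_form A (delta_mx 0 i) (delta_mx 0 j).

Definition typeA7 (A : quadNovikov 'rV[K]_3) := exists k t : K,
  [/\ k ^+ 3 != 0,
      char_mx A = mx3 [:: [:: 0; 0; 0];
                          [:: 0; 0; e1];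
                          [:: 0; (- 2) *: e1; e2]]
    & metric_mx A = mx3 [:: [:: 0; 0; k];
                            [:: 0; k; 0];
                            [:: k; 0; t]]].

Definition typeC5 (A : quadNovikov 'rV[K]_3) := exists k s : K,
  [/\ k ^+ 2 * s != 0,
      char_mx A = mx3 [:: [:: 0; 0; e1];
                          [:: 0; 0; 0];
                          [:: (- 2) *: e1; 0; e3]]
    & metric_mx A = mx3 [:: [:: 0; 0; k];
                            [:: 0; s; 0];
                            [:: k; 0; 0]]].

Definition typeD6 (A : quadNovikov 'rV[K]_3) := exists s : K,
  [/\ s ^+ 3 != 0,
      char_mx A = mx3 [:: [:: e2; 0; e1];
                          [:: 0; 0; e2];
                          [:: (- (1 / 2)) *: e1; (- 2) *: e2; e3]]
    & metric_mx A = mx3 [:: [:: - 2 * s; 0; 0];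
                            [:: 0; 0; s];
                            [:: 0; s; 0]]].

End Types.

(* Main.v *)
From HB Require Import structures.
Require Import Defs.
From mathcomp Require Import all_boot all_order all_algebra.
From mathcomp Require Import sesquilinear reals complex.
From mathcomp Require Import spectral ring.
Import GRing.Theory Num.Theory.
Local Open Scope ring_scope.

(* The right multiplications R_a : x |-> x o a commute and are self-adjoint for B, and
   B(a o b, c) + B(b o c, a) + B(c o a, b) = 0. They have a common eigenvector v, which
   can be taken isotropic: an anisotropic one is killed by every R_a, and if a second
   one in its orthogonal is anisotropic too, a combination of both is isotropic. In
   a basis v, u, w with B(v, w) = B(u, u) = 1 and other products 0, every R_a
   is triangular; the cyclic identity and commutation leave three parameters l, m, n:
     v o w = l v,  u o u = m v,  u o w = n v - 2m u,
     w o v = -2l v,  w o u = m u - 2n v,  w o w = l w + n u,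
   subject to m (l + 2m) = 0. The cases m <> 0, then l <> 0, then n <> 0 are of type
   D6, C5 and A7. *)

(** * Common eigenvectors of commuting endomorphisms *)

(** Stability lets each f be restricted to U and written as a matrix in [vbasis U]. The map [psi]
    from row vectors to V is injective and intertwines [M f] with f, so the matrices commute and a
    common eigenvector of them is carried back into U. *)
Lemma common_eigenvector_vspace {C : numClosedFieldType} {V : vectType C}
    (U : {vspace V}) (fs : seq 'End(V)) :
  U != 0%VS -> {in fs, forall f, f @: U <= U}%VS ->
  {in fs &, forall f g, (f \o g = g \o f)%VF} ->
  exists v, [/\ v \in U, v != 0 & {in fs, forall f : 'End(V), f v \in <[v]>%VS}].
Proof.
move=> U0 stab comm; set m := \dim U; pose X := vbasis U.
pose psi (r : 'rV_m) : V := \sum_i r 0 i *: X`_i.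
pose M (f : 'End(V)) : 'M[C]_m := \matrix_(i, j) coord X j (f X`_i).
have XU i : (i < m)%N -> X`_i \in U.
  by move=> im; apply: vbasis_mem; rewrite mem_nth ?size_tuple.
have freeX : free X by exact: basis_free (vbasisP U).
have psiI : injective psi.
  move=> r s rs; apply/rowP => i.
  by rewrite -(coord_sum_free (r 0) i freeX) -(coord_sum_free (s 0) i freeX) -/(psi r) rs.
have psiM f r : f \in fs -> psi (r *m M f) = f (psi r).
  move=> ffs; rewrite linear_sum /=.
  under [RHS]eq_bigr => i _.
    rewrite linearZ /= [f X`_i](coord_vbasis (_ : _ \in U)); last first.
      by apply: (subvP (stab f ffs)); rewrite memv_img ?XU.
    rewrite scaler_sumr; over.
  rewrite exchange_big /=; apply: eq_bigr => j _.
  rewrite mxE scaler_suml; apply: eq_bigr => i _.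
  by rewrite mxE scalerA.
have m0 : (0 < m)%N by rewrite lt0n dimv_eq0.
have [|r r0 /allP rM] := @common_eigenvector C m [seq M f | f <- fs] m0.
  move=> _ _ /mapP[f ffs ->] /mapP[g gfs ->].
  apply/row_matrixP => i; rewrite !rowE; apply: psiI.
  by rewrite !mulmxA !psiM // -!comp_lfunE comm.
exists (psi r); split.
- by apply: memv_suml => i _; rewrite memvZ ?XU.
- apply: contraNneq r0 => r0; apply/eqP/psiI; rewrite r0.
  by rewrite /psi big1 // => i _; rewrite mxE scale0r.
move=> f ffs; have /sub_rVP[k kE] := rM _ (map_f M ffs).
apply/vlineP; exists k; rewrite -psiM // kE /psi scaler_sumr.
by apply: eq_bigr => i _; rewrite mxE scalerA.
Qed.

(** * Transport of structure and coordinates *)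

Definition transport_mul {K : fieldType} {V W : vectType K} (A : novikovAlg V)
  (phi : {linear V -> W}) (psi : {linear W -> V}) (x y : W) : W :=
  phi (A (psi x) (psi y)).

Lemma transport_mul_bilinear {K : fieldType} {V W : vectType K}
    (A : novikovAlg V) (phi : {linear V -> W}) (psi : {linear W -> V}) :
  bilinear_for *:%R *:%R (transport_mul A phi psi).
Proof.
split=> z a x y; rewrite /transport_mul.
  by rewrite !linearP linearPl linearP.
by rewrite !linearP.
Qed.

HB.instance Definition _ {K : fieldType} {V W : vectType K} (A : novikovAlg V)
    (phi : {linear V -> W}) (psi : {linear W -> V}) :=
  bilinear_isBilinear.Build K W W W *:%R *:%R (transport_mul A phi psi)
    (transport_mul_bilinear A phi psi).

Definition transport_form {K : fieldType} {V W : vectType K} (B : {symmetric V})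
  (psi : {linear W -> V}) (x y : W) : K := B (psi x) (psi y).

Lemma transport_form_bilinear {K : fieldType} {V W : vectType K}
    (B : {symmetric V}) (psi : {linear W -> V}) :
  bilinear_for *%R (idfun \; *%R) (transport_form B psi).
Proof.
split=> z a x y; rewrite /transport_form.
  by rewrite linearP linearPl.
by rewrite !linearP.
Qed.

HB.instance Definition _ {K : fieldType} {V W : vectType K}
    (B : {symmetric V}) (psi : {linear W -> V}) :=
  bilinear_isBilinear.Build K W W K *%R (idfun \; *%R) (transport_form B psi)
    (transport_form_bilinear B psi).

Lemma transport_form_sym {K : fieldType} {V W : vectType K}
    (B : {symmetric V}) (psi : {linear W -> V}) x y :
  transport_form B psi x y = (-1) ^+ false * idfun (transport_form B psi y x).
Proof. by rewrite /transport_form hermC. Qed.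

HB.instance Definition _ {K : fieldType} {V W : vectType K}
    (B : {symmetric V}) (psi : {linear W -> V}) :=
  isHermitianSesquilinear.Build K W false idfun (transport_form B psi)
    (transport_form_sym B psi).

(** The axioms are equations, preserved under conjugation by [phi]. For nondegeneracy, [psi] sends
    the radical of the new form into the radical of the old one, which is zero. *)
Lemma quadNovikov_transport {K : fieldType} {V W : vectType K}
    (A : quadNovikov V) (phi : {linear V -> W}) (psi : {linear W -> V}) :
  cancel phi psi -> cancel psi phi ->
  exists A' : quadNovikov W,
    (forall a b, A' (phi a) (phi b) = phi (A a b)) /\
    (forall a b, qn_form A' (phi a) (phi b) = qn_form A a b).
Proof.
move=> phiK psiK; pose mul : {bilinear W -> W -> W} := transport_mul A phi psi.
pose B : {symmetric W} := transport_form (qn_form A) psi.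
have lsym a b c : mul (mul a b) c - mul a (mul b c) = mul (mul b a) c - mul b (mul a c).
  by rewrite /mul /= /transport_mul !phiK -!linearB nov_lsym.
have rcomm a b c : mul (mul a b) c = mul (mul a c) b.
  by rewrite /mul /= /transport_mul !phiK nov_rcomm.
pose N := NovikovAlg lsym rcomm.
have nd : nondegenerate B.
  apply/eqP/vspaceP => x; rewrite memv0; apply/mem_orthovP/eqP => [x0|-> y _]; last first.
    by rewrite linear0l.
  suff : psi x \in orthov (qn_form A) fullv.
    rewrite (eqP (qn_nondeg A)) memv0 => /eqP px; rewrite -[x]psiK px linear0 //.
  apply/mem_orthovP => y _; rewrite -[y]phiK; exact: (x0 (phi y) (memvf _)).
have inv a b c : B (N a b) c = - B b (nov_star N a c).
  by rewrite /B /= /transport_form /nov_star /= /transport_mul linearD /= !phiK qn_inv.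
exists (QuadNovikov nd inv); split=> a b /=.
  by rewrite /transport_mul !phiK.
by rewrite /transport_form !phiK.
Qed.

(** Transport along the coordinate map of [X], whose inverse sends r to the sum of the r_i X_i. *)
Lemma quadNovikov_basis {K : fieldType} {V : vectType K} (A : quadNovikov V) n
    (X : n.-tuple V) : basis_of fullv X ->
  exists (A' : quadNovikov 'rV[K]_n) (phi : {linear V -> 'rV[K]_n}),
  [/\ bijective phi, forall a b, A' (phi a) (phi b) = phi (A a b),
      forall a b, qn_form A' (phi a) (phi b) = qn_form A a b
    & forall i : 'I_n, phi X`_i = delta_mx 0 i].
Proof.
move=> Xb.
have phiL : linear (fun v => \row_i coord X i v).
  by move=> c x y; apply/rowP => i; rewrite !mxE linearP.
have psiL : linear (fun r : 'rV[K]_n => \sum_i r 0 i *: X`_i).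
  move=> c x y; rewrite scaler_sumr -big_split /=; apply: eq_bigr => i _.
  by rewrite !mxE scalerDl scalerA.
pose phi : {linear V -> 'rV[K]_n} :=
  HB.pack (fun v => \row_i coord X i v) (GRing.isLinear.Build _ _ _ _ _ phiL).
pose psi : {linear 'rV[K]_n -> V} :=
  HB.pack (fun r : 'rV[K]_n => \sum_i r 0 i *: X`_i)
    (GRing.isLinear.Build _ _ _ _ _ psiL).
have phiK : cancel phi psi.
  move=> v /=; rewrite [RHS](coord_basis Xb (memvf v)).
  by apply: eq_bigr => i _; rewrite mxE.
have psiK : cancel psi phi.
  move=> r; apply/rowP => i; rewrite /= mxE coord_sum_free //.
  exact: basis_free Xb.
have [A' [A'M A'B]] := quadNovikov_transport A phi psi phiK psiK.
exists A', phi; split=> // [|i]; first by exists psi.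
apply/rowP => j; rewrite /= !mxE eqxx coord_free ?(basis_free Xb) //.
by rewrite eq_sym.
Qed.

(** * Identities for the form, and an isotropic common eigenvector *)

Section QuadraticNovikov.
Context {C : numClosedFieldType} {V : vectType C} (A : quadNovikov V).
Local Notation "''[' x , y ]" := (qn_form A x%R y%R) : ring_scope.
Local Notation "x ** y" := (qn_alg A x y) (at level 40, left associativity).

Lemma form_sym x y : '[x, y] = '[y, x].
Proof. by rewrite hermC expr0 mul1r. Qed.

Lemma form_nondeg x : (forall y, '[x, y] = 0) -> x = 0.
Proof.
move=> x0; apply/eqP; rewrite -memv0 -(eqP (qn_nondeg A)).
by apply/mem_orthovP => y _.
Qed.

(** Invariance for (a, b, c) and for (a, c, b) both express B(a o b, c) + B(a o c, b): once as -B(b,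
    c o a), once as -B(b o a, c). *)
Lemma form_mulr_adj a b c : '[b ** a, c] = '[b, c ** a].
Proof.
have h1 : '[a ** b, c] = - '[b, a ** c] - '[b, c ** a].
  by rewrite qn_inv linearDr opprD.
have h2 : '[a ** c, b] = - '[c, a ** b] - '[c, b ** a].
  by rewrite qn_inv linearDr opprD.
move: h1 h2; rewrite [ '[b, a ** c] ]form_sym [ '[c, a ** b] ]form_sym.
rewrite [ '[c, b ** a] ]form_sym => h1 h2.
apply: oppr_inj; transitivity ('[a ** b, c] + '[a ** c, b]).
  by rewrite h2; ring.
by rewrite h1; ring.
Qed.

(** This is invariance, with B(a o c, b) replaced by B(b o c, a) because R_c is self-adjoint. *)
Lemma form_cyclic a b c : '[a ** b, c] + '[b ** c, a] + '[c ** a, b] = 0.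
Proof.
have h : '[a ** b, c] = - '[a ** c, b] - '[c ** a, b].
  by rewrite qn_inv linearDr /= opprD !(form_sym b).
by rewrite h (form_mulr_adj c b) (form_sym b); ring.
Qed.

Definition common_eigen (v : V) := forall a, v ** a \in <[v]>%VS.

Lemma common_eigenP v : common_eigen v -> forall a, exists k, v ** a = k *: v.
Proof. by move=> ev a; apply/vlineP. Qed.

(** Right commutativity says exactly that the R_a commute. A finite list is needed, so a runs over a
    basis first; linearity in a gives the rest. *)
Lemma exists_common_eigen (U : {vspace V}) :
  U != 0%VS -> (forall x a, x \in U -> x ** a \in U) ->
  exists v, [/\ v \in U, v != 0 & common_eigen v].
Proof.
move=> U0 stab.
pose Rm a : 'End(V) := linfun (applyr (nov_mul (qn_alg A)) a).
have RmE a x : Rm a x = x ** a by rewrite lfunE.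
have [||v [vU v0 /= vE]] := common_eigenvector_vspace U (map Rm (vbasis {:V})) U0.
- move=> _ /mapP[a _ ->]; apply/subvP => _ /memv_imgP[x xU ->].
  by rewrite RmE stab.
- move=> _ _ /mapP[a _ ->] /mapP[b _ ->]; apply/lfunP => x.
  by rewrite !comp_lfunE !RmE nov_rcomm.
exists v; split=> // a; rewrite (coord_vbasis (memvf a)) linear_sum /=.
apply: memv_suml => i _; rewrite linearZ /=; apply: memvZ; rewrite -RmE.
by rewrite vE // map_f // mem_nth ?size_tuple.
Qed.

(** Let v o v = l v. The cyclic identity at (v, v, v) gives 3 l B(v, v) = 0, so l = 0. At (v, a, v)
    two of the terms contain v o v, one of them after self-adjointness, which leaves B(v o a, v) =
    0. *)
Lemma anisotropic_eigen_annihilates v :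
  common_eigen v -> '[v, v] != 0 -> forall a, v ** a = 0.
Proof.
move=> ev vv; have [l vl] := common_eigenP _ ev v.
have l0 : l = 0.
  have := form_cyclic v v v; rewrite vl linearZl /= -!mulr2n -mulrSr.
  move/eqP; rewrite mulrn_eq0 mulf_eq0 (negPf vv) orbF /=; exact: eqP.
move=> a; have [k va] := common_eigenP _ ev a.
have := form_cyclic v a v; rewrite (form_mulr_adj v a) vl va l0 scale0r.
rewrite linear0r linear0l linearZl /= !addr0 => /eqP.
by rewrite mulf_eq0 (negPf vv) orbF => /eqP ->; rewrite scale0r.
Qed.

Lemma exists_isotropic_eigen : (1 < \dim {:V})%N ->
  exists v, [/\ v != 0, '[v, v] = 0 & common_eigen v].
Proof.
move=> dimV; have [||v [_ v0 ev]] := exists_common_eigen fullv.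
- by rewrite -dimv_eq0 -lt0n ltnW.
- by move=> x a _; rewrite memvf.
have [vv|vv] := eqVneq '[v, v] 0; first by exists v.
have va := anisotropic_eigen_annihilates v ev vv.
(* The orthogonal of v has dimension at least dim V - 1 > 0. It is stable under every R_a, since R_a
   is self-adjoint and kills v. *)
have [||u [uv u0 eu]] := exists_common_eigen (orthov (qn_form A) <[v]>).
- have := @leqif_dim_orthov1_full _ _ _ _ (qn_form A) v (ltnW dimV).
  move=> [h _]; rewrite -dimv_eq0 -lt0n (leq_trans _ h) //.
  by case: (\dim _) dimV => [|[]].
- by move=> x a; rewrite !mem_orthov1 form_mulr_adj va linear0r.
have [uu|uu] := eqVneq '[u, u] 0; first by exists u.
have ua := anisotropic_eigen_annihilates u eu uu.
move: uv; rewrite mem_orthov1 => /eqP uv.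
(* The choice c^2 B(u, u) = -B(v, v) makes x isotropic; x is nonzero because B(x, v) = B(v, v). *)
pose c := sqrtC (- '[v, v] / '[u, u]); pose x := v + c *: u.
have xv : '[x, v] = '[v, v] by rewrite linearDl linearZl /= uv mulr0 addr0.
exists x; split.
- by apply: contraNneq vv => x0; rewrite -xv x0 linear0l.
- rewrite linearDr linearZr /= xv linearDl linearZl /= (form_sym v u) uv add0r.
  by rewrite mulrA -expr2 sqrtCK divfK ?addrN.
by move=> a; rewrite linearDl linearZl /= va ua scaler0 addr0 mem0v.
Qed.

(** * Witt frames and the multiplication table *)

(** A hyperbolic pair v, w and a unit vector u orthogonal to it. The last clause expresses spanning,
    with coordinates read off by the dual basis w, u, v. *)
Definition witt_frame (v u w : V) :=
  [/\ [/\ '[v, v] = 0, '[v, u] = 0 & '[v, w] = 1],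
      [/\ '[u, u] = 1, '[u, w] = 0 & '[w, w] = 0]
    & forall x, x = '[x, w] *: v + '[x, u] *: u + '[x, v] *: w].

Lemma exists_witt_frame (v : V) : \dim {:V} = 3%N -> v != 0 -> '[v, v] = 0 ->
  exists u w, witt_frame v u w.
Proof.
move=> dimV v0 vv.
have [y vy] : exists y, '[v, y] != 0.
  have /mem_orthovPn[y _ vy] : v \notin orthov (qn_form A) fullv; last by exists y.
  by rewrite (eqP (qn_nondeg A)) memv0.
have [z vz] : exists z, '[v, z] = 1.
  by exists ('[v, y]^-1 *: y); rewrite linearZr /= mulVf.
have [w [vw ww]] : exists w, '[v, w] = 1 /\ '[w, w] = 0.
  (* Subtracting c v keeps the product with v and lowers the square B(z, z) by 2c. *)
  exists (z - ('[z, z] / 2) *: v).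
  rewrite !linearBr !linearZr /= !linearBl !linearZl /= vv vz (form_sym z v) vz.
  by split; first ring; field.
have [x xvw] : exists x, x \notin <<[:: v; w]>>%VS.
  have : ~~ (fullv <= <<[:: v; w]>>)%VS.
    by apply/negP => /dimvS; rewrite dimV leqNgt (leq_ltn_trans (dim_span _)).
  by case/subvPn => x _; exists x.
(* Projection of x away from the hyperbolic plane of v and w. *)
have [t tE] : exists t, t = x - '[x, w] *: v - '[x, v] *: w by eexists.
have tv : '[t, v] = 0.
  by rewrite tE !linearBl !linearZl /= vv (form_sym w) vw; ring.
have tw : '[t, w] = 0 by rewrite tE !linearBl !linearZl /= ww vw; ring.
have fr : free [:: t; v; w].
  rewrite free_cons; apply/andP; split.
    apply: contra xvw => tin.
    have -> : x = t + '[x, v] *: w + '[x, w] *: v by rewrite tE !subrK.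
    have vin : v \in <<[:: v; w]>>%VS by rewrite memv_span ?mem_head.
    have win : w \in <<[:: v; w]>>%VS by rewrite memv_span // !inE eqxx orbT.
    by apply: memvD (memvZ _ vin); apply: memvD (memvZ _ win).
  have w0 : w != 0 by apply: contra_eq_neq vw => ->; rewrite linear0r eq_sym oner_neq0.
  rewrite free_cons seq1_free span_seq1 w0 andbT.
  apply/negP => /vlineP[k vk]; move/eqP: vw.
  by rewrite form_sym -[v](_ : k *: w = v) // linearZr /= ww mulr0 eq_sym oner_eq0.
have perp0 y' : '[y', t] = 0 -> '[y', v] = 0 -> '[y', w] = 0 -> y' = 0.
  move=> y't y'v y'w; apply: form_nondeg => z'; have : z' \in <<[:: t; v; w]>>%VS.
    suff -> : <<[:: t; v; w]>>%VS = fullv by rewrite memvf.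
    by apply/eqP; rewrite eqEdim subvf (eqP fr) dimV.
  apply/mem_orthovP; rewrite -[y' \in _]/(<[y']> <= _)%VS -span_seq1 -orthogonalE.
  by rewrite /orthogonal /= y't y'v y'w eqxx.
(* An isotropic t would be orthogonal to the basis t, v, w, hence zero. So t can be normalised by a
   square root of B(t, t). *)
have tt : '[t, t] != 0.
  apply/eqP => tt; move: fr; rewrite (perp0 t) // free_cons mem0v //.
pose s := sqrtC '[t, t]; have s2 : s ^+ 2 = '[t, t] by rewrite sqrtCK.
have s0 : s != 0 by rewrite sqrtC_eq0.
have [u uE] : exists u, u = s^-1 *: t by eexists.
have uu : '[u, u] = 1 by rewrite uE linearZl linearZr /= -s2; field.
have uv : '[u, v] = 0 by rewrite uE linearZl /= tv mulr0.
have uw : '[u, w] = 0 by rewrite uE linearZl /= tw mulr0.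
exists u, w; split; [by split=> //; rewrite form_sym | by [] | move=> r].
(* The difference of r and its expansion is orthogonal to t, v and w; for t this is checked on its
   multiple u. *)
apply/eqP; rewrite -subr_eq0; apply/eqP; apply: perp0.
- apply: (mulfI (invr_neq0 s0)); rewrite mulr0 -linearZr /= -uE.
  rewrite linearBl !linearDl !linearZl /= uu (form_sym v) uv (form_sym w) uw; ring.
- by rewrite linearBl !linearDl !linearZl /= vv uv (form_sym w) vw; ring.
- by rewrite linearBl !linearDl !linearZl /= vw uw ww; ring.
Qed.

(** Coordinates as explicit scalar arguments, so that [congr comb] turns an equation of vectors into
    three scalar equations. *)
Definition comb (v u w : V) (a b c : C) : V := a *: v + b *: u + c *: w.

Lemma form_comb v u w a b c a' b' c' : witt_frame v u w ->
  '[comb v u w a b c, comb v u w a' b' c'] = a * c' + b * b' + c * a'.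
Proof.
move=> [[vv vu vw] [uu uw ww] _]; rewrite /comb.
rewrite !(linearDl, linearDr, linearZl, linearZr) /=.
rewrite vv vu vw uu uw ww (form_sym u v) (form_sym w v) (form_sym w u) vu vw uw.
ring.
Qed.

Lemma witt_frame_table v u w : witt_frame v u w -> common_eigen v ->
  exists l m n, m * (l + 2 * m) = 0 /\ forall a b c a' b' c',
    comb v u w a b c ** comb v u w a' b' c' =
    comb v u w
      (a * c' * l + b * b' * m + b * c' * n - 2 * c * a' * l - 2 * c * b' * n)
      (c * b' * m - 2 * b * c' * m + c * c' * n) (c * c' * l).
Proof.
move=> [[vv vu vw] [uu uw ww] frame] ev.
pose L x := '[v ** x, w].
have vx x : v ** x = L x *: v.
  by have [k vk] := common_eigenP _ ev x; rewrite /L vk linearZl /= vw mulr1.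
have Tvv x : '[v ** x, v] = 0 by rewrite vx linearZl /= vv mulr0.
have Tvu x : '[v ** x, u] = 0 by rewrite vx linearZl /= vu mulr0.
have Twv x : '[w ** x, v] = L x by rewrite form_mulr_adj form_sym.
have Tuv x : '[u ** x, v] = 0 by rewrite form_mulr_adj form_sym.
have Twu x : '[w ** x, u] = '[u ** x, w] by rewrite form_mulr_adj form_sym.
(* By self-adjointness the triangular matrix of R_x is symmetric across its antidiagonal, so [L],
   [M], [N], [X] describe it completely. *)
pose M x := '[u ** x, u]; pose N x := '[u ** x, w]; pose X x := '[w ** x, w].
have ux x : u ** x = N x *: v + M x *: u.
  by rewrite [LHS]frame Tuv scale0r addr0.
have wx x : w ** x = X x *: v + N x *: u + L x *: w.
  by rewrite [LHS]frame Twu Twv.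
(* The cyclic identity on triples of frame vectors expresses all values of these four functionals on
   the frame through L u, L w, N u and N w. *)
have Lv : L v = 0.
  have := form_cyclic v v w; rewrite Tvv Twv addr0 -/(L v) => /eqP.
  by rewrite -mulr2n mulrn_eq0 => /eqP.
have Nv : N v = - L u.
  have := form_cyclic v u w; rewrite Tuv Twu addr0 addrC => /eqP.
  by rewrite addr_eq0 => /eqP.
have Xv : X v = - 2 * L w.
  have := form_cyclic w w v; rewrite Twv -/(X v) -/(L w) => h.
  by apply/eqP; rewrite -subr_eq0 -h; apply/eqP; ring.
have Mv : M v = 0 by have := form_cyclic u u v; rewrite Tuv Tvu add0r addr0.
have Mu : M u = 0.
  have := form_cyclic u u u; rewrite -!mulr2n -mulrSr => /eqP.
  by rewrite mulrn_eq0 => /eqP.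
have Mw : M w = - 2 * N u.
  have := form_cyclic u u w; rewrite Twu -/(N u) -/(M w) => h.
  by apply/eqP; rewrite -subr_eq0 -h; apply/eqP; ring.
have Xu : X u = - 2 * N w.
  have := form_cyclic w w u; rewrite Twu -/(N w) -/(X u) => h.
  by apply/eqP; rewrite -subr_eq0 -h; apply/eqP; ring.
have Xw : X w = 0.
  have := form_cyclic w w w; rewrite -!mulr2n -mulrSr => /eqP.
  by rewrite mulrn_eq0 => /eqP.
have v0 : v != 0 by apply: contra_eq_neq vw => ->; rewrite linear0l eq_sym oner_neq0.
(* Comparing (u o v) o u with (u o u) o v gives -(L u)^2 v = 0. *)
have Lu : L u = 0.
  have := nov_rcomm A u v u; rewrite !ux Mv Mu !scale0r !addr0 Nv.
  rewrite !linearZl /= !vx Lv scale0r scaler0 scalerA => /eqP.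
  by rewrite scaler_eq0 (negPf v0) orbF mulNr oppr_eq0 mulf_eq0 orbb => /eqP.
exists (L w), (N u), (N w); split.
  (* Here (u o u) o w = m l v, while (u o w) o u = -2 m^2 v. *)
  have := nov_rcomm A u u w; rewrite !ux Mu scale0r addr0 linearDl !linearZl /=.
  rewrite !vx ux Lu Mu !scale0r scaler0 add0r addr0 !scalerA Mw => /eqP.
  rewrite -subr_eq0 -scalerBl scaler_eq0 (negPf v0) orbF => /eqP h.
  by rewrite -h; ring.
have coords x y : '[x, w] = '[y, w] -> '[x, u] = '[y, u] -> '[x, v] = '[y, v] -> x = y.
  by move=> xw xu xv; rewrite [x]frame [y]frame xw xu xv.
move=> a b c a' b' c'; rewrite /comb.
rewrite !(linearDl, linearDr, linearZl, linearZr) /= !(vx, ux, wx).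
rewrite Lv Nv Xv Mv Mu Mw Xu Xw Lu.
apply: coords; rewrite !(linearDl, linearZl) /=;
  rewrite ?vv ?uu ?ww ?(form_sym u v) ?(form_sym w v) ?(form_sym w u) ?vu ?vw ?uw;
  ring.
Qed.

Lemma basis_witt_frame (v u w x y z : V) : \dim {:V} = 3%N -> witt_frame v u w ->
  v \in <<[:: x; y; z]>>%VS -> u \in <<[:: x; y; z]>>%VS ->
  w \in <<[:: x; y; z]>>%VS -> basis_of fullv [tuple x; y; z].
Proof.
move=> dimV [_ _ frame] vX uX wX; rewrite basisEdim dimV leqnn andbT.
apply/subvP => r _; rewrite [r]frame.
by apply: memvD (memvZ _ wX); apply: memvD (memvZ _ uX); apply: memvZ.
Qed.

End QuadraticNovikov.

(** * Recognition of the three types from a basis of V *)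

(** Reduces membership in a type to products and form values inside V. By symmetry, six form values
    fill the metric matrix. *)
Lemma exists_quadNovikov_rV3 {K : fieldType} {V : vectType K} (A : quadNovikov V)
    x1 x2 x3 : basis_of fullv [tuple x1; x2; x3] ->
  exists (A' : quadNovikov 'rV[K]_3) (phi : {linear V -> 'rV[K]_3}),
  [/\ qn_isomorphic A A', [/\ phi x1 = e1 K, phi x2 = e2 K & phi x3 = e3 K],
      char_mx A' = mx3 [:: [:: phi (A x1 x1); phi (A x1 x2); phi (A x1 x3)];
                           [:: phi (A x2 x1); phi (A x2 x2); phi (A x2 x3)];
                           [:: phi (A x3 x1); phi (A x3 x2); phi (A x3 x3)]]
    & metric_mx A' = mx3 [:: [:: qn_form A x1 x1; qn_form A x1 x2; qn_form A x1 x3];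
                             [:: qn_form A x1 x2; qn_form A x2 x2; qn_form A x2 x3];
                             [:: qn_form A x1 x3; qn_form A x2 x3; qn_form A x3 x3]]].
Proof.
move=> /(quadNovikov_basis A 3)[A' [phi [phi_bij phiM phiB phiE]]].
exists A', phi; split.
- by exists phi; split.
- by split; [exact: (phiE (@Ordinal 3 0 isT)) | exact: (phiE (@Ordinal 3 1 isT))
            | exact: (phiE (@Ordinal 3 2 isT))].
- apply/matrixP => i j; rewrite !mxE -!phiE phiM.
  by case: i => [[|[|[|]]]] //= ?; case: j => [[|[|[|]]]].
apply/matrixP => i j; rewrite !mxE -!phiE phiB.
by case: i => [[|[|[|]]]] //= ?; case: j => [[|[|[|]]]] //= ?; rewrite hermC expr0 mul1r.
Qed.

Lemma quadNovikov_typeA7 {K : fieldType} {V : vectType K}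
    (A : quadNovikov V) (x1 x2 x3 : V) k t :
  basis_of fullv [tuple x1; x2; x3] -> k ^+ 3 != 0 ->
  [/\ A x1 x1 = 0, A x1 x2 = 0 & A x1 x3 = 0] ->
  [/\ A x2 x1 = 0, A x2 x2 = 0 & A x2 x3 = x1] ->
  [/\ A x3 x1 = 0, A x3 x2 = (- 2) *: x1 & A x3 x3 = x2] ->
  [/\ qn_form A x1 x1 = 0, qn_form A x1 x2 = 0 & qn_form A x1 x3 = k] ->
  [/\ qn_form A x2 x2 = k, qn_form A x2 x3 = 0 & qn_form A x3 x3 = t] ->
  exists A' : quadNovikov 'rV[K]_3, qn_isomorphic A A' /\ typeA7 A'.
Proof.
move=> /(exists_quadNovikov_rV3 A)[A' [phi [iso [phi1 phi2 phi3] mulE formE]]] k0.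
move=> [m11 m12 m13] [m21 m22 m23] [m31 m32 m33] [b11 b12 b13] [b22 b23 b33].
exists A'; split=> //; exists k, t; split=> //.
  rewrite mulE m11 m12 m13 m21 m22 m23 m31 m32 m33.
  by rewrite !linearZ !linear0 phi1 phi2.
by rewrite formE b11 b12 b13 b22 b23 b33.
Qed.

Lemma quadNovikov_typeC5 {K : fieldType} {V : vectType K}
    (A : quadNovikov V) (x1 x2 x3 : V) k s :
  basis_of fullv [tuple x1; x2; x3] -> k ^+ 2 * s != 0 ->
  [/\ A x1 x1 = 0, A x1 x2 = 0 & A x1 x3 = x1] ->
  [/\ A x2 x1 = 0, A x2 x2 = 0 & A x2 x3 = 0] ->
  [/\ A x3 x1 = (- 2) *: x1, A x3 x2 = 0 & A x3 x3 = x3] ->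
  [/\ qn_form A x1 x1 = 0, qn_form A x1 x2 = 0 & qn_form A x1 x3 = k] ->
  [/\ qn_form A x2 x2 = s, qn_form A x2 x3 = 0 & qn_form A x3 x3 = 0] ->
  exists A' : quadNovikov 'rV[K]_3, qn_isomorphic A A' /\ typeC5 A'.
Proof.
move=> /(exists_quadNovikov_rV3 A)[A' [phi [iso [phi1 phi2 phi3] mulE formE]]] ks0.
move=> [m11 m12 m13] [m21 m22 m23] [m31 m32 m33] [b11 b12 b13] [b22 b23 b33].
exists A'; split=> //; exists k, s; split=> //.
  rewrite mulE m11 m12 m13 m21 m22 m23 m31 m32 m33.
  by rewrite !linearZ !linear0 phi1 phi3.
by rewrite formE b11 b12 b13 b22 b23 b33.
Qed.

Lemma quadNovikov_typeD6 {K : fieldType} {V : vectType K}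
    (A : quadNovikov V) (x1 x2 x3 : V) s :
  basis_of fullv [tuple x1; x2; x3] -> s ^+ 3 != 0 ->
  [/\ A x1 x1 = x2, A x1 x2 = 0 & A x1 x3 = x1] ->
  [/\ A x2 x1 = 0, A x2 x2 = 0 & A x2 x3 = x2] ->
  [/\ A x3 x1 = (- (1 / 2)) *: x1, A x3 x2 = (- 2) *: x2 & A x3 x3 = x3] ->
  [/\ qn_form A x1 x1 = - 2 * s, qn_form A x1 x2 = 0 & qn_form A x1 x3 = 0] ->
  [/\ qn_form A x2 x2 = 0, qn_form A x2 x3 = s & qn_form A x3 x3 = 0] ->
  exists A' : quadNovikov 'rV[K]_3, qn_isomorphic A A' /\ typeD6 A'.
Proof.
move=> /(exists_quadNovikov_rV3 A)[A' [phi [iso [phi1 phi2 phi3] mulE formE]]] s0.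
move=> [m11 m12 m13] [m21 m22 m23] [m31 m32 m33] [b11 b12 b13] [b22 b23 b33].
exists A'; split=> //; exists s; split=> //.
  rewrite mulE m11 m12 m13 m21 m22 m23 m31 m32 m33.
  by rewrite !linearZ !linear0 phi1 phi2 phi3.
by rewrite formE b11 b12 b13 b22 b23 b33.
Qed.

(** * Case analysis on the parameters l, m, n *)

(** Algebraic closure supplies the common eigenvectors and the square roots; characteristic zero
    allows the divisions by 2 and 3. *)
Lemma quadNovikov3_classification {C : numClosedFieldType} {V : vectType C}
    (A : quadNovikov V) :
  \dim {:V} = 3%N -> ~ nov_trivial A ->
  exists A' : quadNovikov 'rV[C]_3,
    qn_isomorphic A A' /\ (typeA7 A' \/ typeC5 A' \/ typeD6 A').
Proof.
move=> dimV ntriv.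
have [|v [v0 vv ev]] := exists_isotropic_eigen A; first by rewrite dimV.
have [u [w fr]] := exists_witt_frame A v dimV v0 vv.
have [l [m [n [ml tab]]]] := witt_frame_table A v u w fr ev.
have formE a b c a' b' c' := form_comb A v u w a b c a' b' c' fr.
have eZ k a b c : k *: comb v u w a b c = comb v u w (k * a) (k * b) (k * c).
  by rewrite /comb !scalerDr !scalerA.
have e0 : comb v u w 0 0 0 = 0 by rewrite /comb !scale0r !addr0.
(* A triangular change of basis with nonzero diagonal: v, u, w are recovered in turn by
   elimination. *)
have basisE a b1 b2 c1 c2 c3 : a != 0 -> b2 != 0 -> c3 != 0 ->
  basis_of fullv [tuple comb v u w a 0 0; comb v u w b1 b2 0; comb v u w c1 c2 c3].
  move=> a0 b0 c0.
  set x := comb v u w a 0 0; set y := comb _ _ _ _ _ 0; set z := comb _ _ _ _ _ c3.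
  have [xX yX zX] : [/\ x \in <<[:: x; y; z]>>%VS, y \in <<[:: x; y; z]>>%VS
     & z \in <<[:: x; y; z]>>%VS] by split; rewrite memv_span // !inE eqxx ?orbT.
  have vE : v = a^-1 *: x.
    by rewrite /x eZ mulVf // !mulr0 /comb scale1r !scale0r !addr0.
  have uE : u = b2^-1 *: (y - b1 *: v).
    by rewrite /y /comb scale0r addr0 addrAC subrr add0r scalerK.
  have wE : w = c3^-1 *: (z - c1 *: v - c2 *: u).
    by rewrite /z /comb -[_ - _ - _]addrA -opprD addrAC subrr add0r scalerK.
  have vX : v \in <<[:: x; y; z]>>%VS by rewrite vE memvZ.
  have uX : u \in <<[:: x; y; z]>>%VS.
    by rewrite uE; apply: memvZ; apply: memvB => //; apply: memvZ.
  apply: (basis_witt_frame A v u w x y z dimV fr vX uX).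
  rewrite wE; apply: memvZ; apply: memvB; last by apply: memvZ.
  by apply: memvB => //; apply: memvZ.
have basis_swap (x1 x2 x3 : V) :
    basis_of fullv [tuple x1; x2; x3] -> basis_of fullv [tuple x2; x1; x3].
  rewrite !basisEdim /= => /andP[x123 ->]; rewrite andbT.
  by apply: subv_trans x123 _; apply: sub_span => r; rewrite !inE orbCA.
have [m0|m0] := eqVneq m 0; last first.
  have lE : l = - 2 * m.
    move/eqP: ml; rewrite mulf_eq0 (negPf m0) addr_eq0 => /eqP ->.
    by rewrite mulNr.
  (* The third vector x3 is the only idempotent with nonzero w-coordinate, which must be 1/l =
     -1/(2m). The first, x1, is u plus the multiple of v that makes it orthogonal to x3, and x2 = x1
     o x1 = m v. Then B(x1, x1) = 1 = -2s forces s = -1/2. *)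
  have [|||||||A' [iso tA]] := quadNovikov_typeD6 A (comb v u w (n / m) 1 0)
     (comb v u w m 0 0)
     (comb v u w (n ^+ 2 / (4 * m ^+ 3)) (n / (2 * m ^+ 2)) (- (2 * m)^-1)) (- (1 / 2)).
  - by apply: basis_swap; apply: basisE;
      rewrite ?oppr_eq0 ?invr_eq0 ?mulf_neq0 ?oner_neq0 ?pnatr_eq0.
  - by rewrite expf_neq0 // oppr_eq0 mulf_neq0 ?invr_eq0 ?oner_neq0 ?pnatr_eq0.
  - by split; rewrite tab -?e0 lE; congr comb; field.
  - by split; rewrite tab -?e0 lE; congr comb; field.
  - by split; rewrite tab ?eZ lE; congr comb; field.
  - by split; rewrite formE; field.
  - by split; rewrite formE; field.
  by exists A'; split=> //; right; right.
have [l0|l0] := eqVneq l 0; last first.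
  (* Again x3 is the idempotent with w-coordinate 1/l, and x2 is u corrected along v to be
     orthogonal to x3. With x1 = v this gives k = B(v, x3) = 1/l and s = B(u, u) = 1. *)
  have [|||||||A' [iso tA]] := quadNovikov_typeC5 A (comb v u w 1 0 0)
     (comb v u w (- n / l) 1 0)
     (comb v u w (- n ^+ 2 / (2 * l ^+ 3)) (n / l ^+ 2) l^-1) l^-1 1.
  - by apply: basisE; rewrite ?invr_eq0 ?oner_neq0.
  - by rewrite mulr1 expf_neq0 // invr_eq0.
  - by split; rewrite tab -?e0 m0; congr comb; field.
  - by split; rewrite tab -?e0 m0; congr comb; field.
  - by split; rewrite tab ?eZ -?e0 m0; congr comb; field.
  - by split; rewrite formE; field.
  - by split; rewrite formE; field.
  by exists A'; split=> //; right; left.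
have [n0|n0] := eqVneq n 0.
  (* With l = m = n = 0 the whole table vanishes, against nontriviality. *)
  case: ntriv => x y; have [_ _ frame] := fr.
  rewrite [x]frame [y]frame -!/(comb _ _ _ _ _ _) tab l0 m0 n0 -e0.
  by congr comb; ring.
(* Everything is generated by x3 = w: x2 = w o w = n u and x1 = x2 o x3 = n^2 v. Hence k = n^2, and
   t = B(w, w) = 0. *)
have [|||||||A' [iso tA]] := quadNovikov_typeA7 A (comb v u w (n ^+ 2) 0 0)
   (comb v u w 0 n 0) (comb v u w 0 0 1) (n ^+ 2) 0.
- by apply: basisE; rewrite ?expf_neq0 ?oner_neq0.
- by rewrite !expf_neq0.
- by split; rewrite tab -?e0 m0 l0; congr comb; ring.
- by split; rewrite tab -?e0 m0 l0; congr comb; ring.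
- by split; rewrite tab ?eZ -?e0 m0 l0; congr comb; ring.
- by split; rewrite formE; ring.
- by split; rewrite formE; ring.
by exists A'; split=> //; left.
Qed.

Theorem theorem3p7 (R : realType) (V : vectType R[i]) (A : quadNovikov V) :
  \dim {:V}%VS = 3%N -> ~ nov_trivial A ->
  exists A' : quadNovikov 'rV[R[i]]_3,
    qn_isomorphic A A' /\ (typeA7 A' \/ typeC5 A' \/ typeD6 A').
Proof. exact: quadNovikov3_classification. Qed.
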